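(* For every integer $n\ge 1$, the polydisk algebra $A(\mathbf D^n)$ is not a coherent ring.
   Context: $\mathbf D=\{z\in\mathbb C:|z|\le 1\}$ is the closed unit disk and $\mathbf D^n\subset\mathbb C^n$ is the closed polydisk. The polydisk algebra $A(\mathbf D^n)$ is the algebra (with pointwise operations and supremum norm) of all continuous functions $f:\mathbf D^n\to\mathbb C$ that are holomorphic in the interior of $\mathbf D^n$. A commutative unital ring is called coherent if the intersection of any two finitely generated ideals is finitely generated. *)

(* Defs.v *)
From HB Require Import structures.
From mathcomp Require Import all_boot all_order all_algebra.
From mathcomp Require Import complex.
From mathcomp Require Import all_classical all_reals all_analysis.

Set Implicit Arguments.
Unset Strict Implicit.
Unset Printing Implicit Defensive.

Import Order.TTheory GRing.Theory Num.Theory.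
Import numFieldNormedType.Exports.

Local Open Scope classical_set_scope.
Local Open Scope ring_scope.

(* The topology of [R[i]] is the one induced by the complex modulus. *)
HB.instance Definition _ (R : rcfType) :=
  PseudoPointedMetric.copy R[i] (R[i]^o).
HB.instance Definition _ (R : rcfType) := GRing.ComAlgebra.copy R[i] (R[i]^o).
HB.instance Definition _ (R : rcfType) := Vector.copy R[i] (R[i]^o).
HB.instance Definition _ (R : rcfType) := NormedModule.copy R[i] (R[i]^o).

Section Coherence.
Variable A : comPzRingType.

Definition is_ideal (I : set A) : Prop :=
  [/\ I 0, (forall x y, I x -> I y -> I (x + y)) &
      (forall a x, I x -> I (a * x))].

Definition ideal_gen (s : seq A) : set A :=
  [set x | exists c : 'I_(size s) -> A, x = \sum_(i < size s) c i * s`_i].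

Definition fg_ideal (I : set A) : Prop := exists s : seq A, I = ideal_gen s.

Definition coherent : Prop :=
  forall I J : set A, fg_ideal I -> fg_ideal J -> fg_ideal (I `&` J).

Lemma ideal_genE (s : seq A) : ideal_gen s = smallest is_ideal [set` s].
Proof.
apply/seteqP; split=> [_ [c ->] I [[I0 ID IM] sI]|x].
  by apply: big_ind => // i _; apply/IM/sI => /=; exact: mem_nth.
apply; split; first split.
- by exists (fun=> 0); rewrite big1 // => i _; rewrite mul0r.
- move=> _ _ [c ->] [d ->]; exists (fun i => c i + d i).
  by rewrite -big_split; apply: eq_bigr => i _; rewrite mulrDl.
- move=> a _ [c ->]; exists (fun i => a * c i).
  by rewrite mulr_sumr; apply: eq_bigr => i _; rewrite mulrA.
move=> _ /= /(nthP 0) [i si <-].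
exists (fun j => (j == Ordinal si)%:R).
rewrite (bigD1 (Ordinal si)) //= eqxx mul1r big1 ?addr0 // => j /negbTE ->.
by rewrite mul0r.
Qed.

End Coherence.

Lemma near_eq_differentiable (K : numFieldType) (V W : normedModType K)
    (f g : V -> W) (x : V) :
  (\forall y \near x, f y = g y) -> differentiable f x -> differentiable g x.
Proof.
move=> fg df.
have fgx : f x = g x by apply: nbhs_singleton fg.
have cdf : continuous ('d f x) by exact: diff_continuous.
have gE : g \o shift x = cst (g x) + 'd f x +o_ 0 id.
  apply/eqaddoP => e e0.
  have /eqaddoP/(_ _ e0) := diff_locally df.
  have : \forall h \near (0 : V), f (h + x) = g (h + x).
    by move: fg; rewrite (near_shift 0) subr0.
  by apply: filterS2 => h /= fgxh; rewrite !fctE/= fgxh fgx.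
by apply/diff_locallyP; rewrite (diff_unique cdf gE).
Qed.

Section PolydiskAlgebra.
Variables (R : realType) (n : nat).

Definition polydisk : set 'rV[R[i]]_n :=
  [set z | forall j, `|z ord0 j| <= 1].

(* [differentiable] is Frechet differentiability over the field [R[i]]. *)
Definition holomorphic_on (U : set 'rV[R[i]]_n) (g : 'rV[R[i]]_n -> R[i]) :
    Prop :=
  forall z, U z -> differentiable g z.

(* ['valL_0 f] extends [f] by 0 outside [polydisk]; the choice of extension
   does not matter, since [differentiable] is local. *)
Definition in_polydisk_algebra : {pred polydisk -> R[i]} :=
  [pred f | `[< continuous f /\
                holomorphic_on (interior polydisk) ('valL_0 f) >]].

Lemma in_polydisk_algebra_subring : subring_closed in_polydisk_algebra.
Proof.
split=> [|f g /asboolP[fc fh] /asboolP[gc gh]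
         |f g /asboolP[fc fh] /asboolP[gc gh]]; apply/asboolP; split.
- exact: (@cst_continuous polydisk R[i] 1).
- move=> z Dz; refine (@near_eq_differentiable R[i] _ R[i] (cst 1) _ z _ _); last first.
    exact: differentiable_cst.
  apply: filterS Dz => w Dw /=.
  by rewrite oinv_set_val insubT ?inE.
- by move=> x; exact: (cvgB (fc x) (gc x)).
- move=> z Dz; have -> : 'valL_0 (f - g) = 'valL_0 f \- 'valL_0 g.
    apply/funext => w /=; rewrite oinv_set_val.
    by case: insubP => [u _ _|_] //=; rewrite subr0.
  exact: (differentiableB (fh z Dz) (gh z Dz)).
- by move=> x; exact: (cvgM (fc x) (gc x)).
- move=> z Dz; have -> : 'valL_0 (f * g) = 'valL_0 f * 'valL_0 g.
    apply/funext => w; rewrite fctE /= oinv_set_val.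
    by case: insubP => [u _ _|_] //=; rewrite mulr0.
  exact: (differentiableM (fh z Dz) (gh z Dz)).
Qed.

Definition polydisk_algebra : Type :=
  {f : polydisk -> R[i] | f \in in_polydisk_algebra}.

HB.instance Definition _ := SubChoice.on polydisk_algebra.
HB.instance Definition _ :=
  GRing.SubChoice_isSubComPzRing.Build (polydisk -> R[i]) in_polydisk_algebra
    polydisk_algebra in_polydisk_algebra_subring.

End PolydiskAlgebra.

(* Main.v *)
Require Import Defs.
From mathcomp Require Import all_boot all_order all_algebra.
From mathcomp Require Import all_classical all_reals all_analysis.
From mathcomp Require Import complex ring lra.

(* Put a = 1 - z_j, so that Re a > 0 on the polydisk off {z_j = 1}. With
   q_m = 16^-m, the bumps t_m(a) = a / (a + q_(m+1)) - a / (a + q_m) satisfy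
   |t_m(a)| <= 4 t_m(|a|) for Re a >= 0, and the t_m(|a|) telescope to a sum at
   most 1. Hence sum_m c_m t_m(a) is bounded for bounded c_m >= 0, holomorphic
   for Re a > 0, and tends to 0 at a = 0 as soon as c_m -> 0.
   Let S be the sum of the t_m with m even: at the points a = x_m = q_m / 4 the
   value of S is >= 3/5 for m even and <= 2/5 for m odd, so S has no limit at 0
   although a S lies in the algebra. Suppose that (a) and (a S) intersect in the
   ideal of finitely many g_i = h_i a = k_i a S. Then h_i = S k_i along x_m
   forces k_i = 0 at a = 0. Take c_m = sqrt (sum_i |k_i(x_m)| + x_m), which tends
   to 0, and f = sum_m c_m t_m. Both f and f S lie in the algebra, so f a S is in
   the intersection and f = sum_i al_i k_i at x_m for m even; but
   |f(x_m)| >= 3/5 c_m while |sum_i al_i k_i| <= (sum_i |al_i|) c_m ^ 2, which is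
   absurd when m is large. *)

Set Implicit Arguments.
Unset Strict Implicit.
Unset Printing Implicit Defensive.

Import Order.TTheory GRing.Theory Num.Theory.
Import numFieldNormedType.Exports.
Import ComplexField.Normc.

Local Open Scope classical_set_scope.
Local Open Scope ring_scope.
Local Open Scope complex_scope.

Local Notation Re := complex.Re.
Local Notation Im := complex.Im.

(** * Real-valued modulus, limits and series in [R[i]] *)

Section ComplexLimits.
Variable R : realType.
Implicit Types (z w : R[i]) (u : R[i] ^nat) (v : R ^nat).

(** The norm of [R[i]] takes values in [R[i]]; [normc] is its real form, in which all estimates are
    carried out. *)
Lemma norm_normc z : `|z| = (normc z)%:C.
Proof. by []. Qed.

Lemma normc_ge0 z : 0 <= normc z.
Proof. by case: z => x y; exact: sqrtr_ge0. Qed.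

Lemma normcD z w : normc (z + w) <= normc z + normc w.
Proof. exact: le_normcD. Qed.

Lemma normcB z w : normc (z - w) = normc (w - z).
Proof. by rewrite -opprB normcN. Qed.

Lemma ler_distc z w : `|normc z - normc w| <= normc (z - w).
Proof.
have h1 := normcD (z - w) w; have h2 := normcD (w - z) z.
rewrite !subrK (normcB w z) in h1 h2.
by rewrite ler_norml; apply/andP; split; lra.
Qed.

Lemma normcR (x : R) : normc x%:C = `|x|.
Proof. by rewrite /normc /= expr0n addr0 sqrtr_sqr. Qed.

Lemma Re_le_normc z : Re z <= normc z.
Proof. by rewrite (le_trans (ler_norm _))// -lecR; exact: normc_ge_Re. Qed.

Lemma normc_eq0 z : (normc z == 0) = (z == 0).
Proof. by apply/eqP/eqP => [/eq0_normc//|->]; rewrite normc0. Qed.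

Lemma cvg_normcP {T} {F : set_system T} {FF : Filter F} (f : T -> R[i]) l :
  f @ F --> l <-> forall e : R, 0 < e -> \forall t \near F, normc (l - f t) < e.
Proof.
split=> [/cvgrPdist_lt fl e e0|fl].
  have /fl : 0 < e%:C by rewrite ltcR.
  by apply: filterS => t; rewrite norm_normc ltcR.
(* A positive element of [R[i]] has zero imaginary part, so real [e] suffice. *)
apply/cvgrPdist_lt => e; rewrite ltcE => /andP[/eqP/= e0 /fl].
by apply: filterS => t; rewrite norm_normc ltcE /= e0 eqxx.
Qed.

Lemma near_normc z (e : R) : 0 < e -> \forall w \near z, normc (z - w) < e.
Proof. by move=> e0; apply: ((cvg_normcP (F := nbhs z) id z).1 _ e e0). Qed.

Lemma normc_continuous : continuous (@normc R).
Proof.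
move=> z; apply/(cvgrPdist_lt (F := nbhs z)) => e e0.
by apply: filterS (near_normc z e0) => w; exact: le_lt_trans (ler_distc _ _).
Qed.

Lemma real_complex_continuous : continuous (real_complex R : R -> R[i]).
Proof.
move=> x; apply/cvg_normcP => e e0.
have /cvgrPdist_lt/(_ e e0) : y @[y --> x] --> x by exact: cvg_id.
by apply: filterS => y; rewrite -(rmorphB (real_complex R)) normcR.
Qed.

Lemma Im_le_normc z : `|Im z| <= normc z.
Proof.
case: z => x y /=; rewrite -(sqrtr_sqr y) ler_wsqrtr// lerDr sqr_ge0 //.
Qed.

Lemma is_cvg_bounded_series (v : R ^nat) M :
  (forall m, 0 <= v m) -> (forall n, series v n <= M) -> cvgn (series v).
Proof.
move=> v0 vM; apply: nondecreasing_is_cvgn; first exact: nondecreasing_series.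
by exists M => _ [n _ <-].
Qed.

Lemma is_cvg_norm_bounded_series (v w : R ^nat) M :
  (forall m, `|w m| <= v m) -> (forall n, series v n <= M) -> cvgn (series w).
Proof.
move=> wv vM; have v0 m : 0 <= v m by apply: le_trans (wv m).
apply: normed_cvg; apply: series_le_cvg wv _ => //.
exact: is_cvg_bounded_series vM.
Qed.

(** The real comparison test is applied to real and imaginary parts. *)
Lemma is_cvg_complex_series u v M :
  (forall m, normc (u m) <= v m) -> (forall n, series v n <= M) ->
  cvgn (series u).
Proof.
move=> uv vM.
have cRe : cvgn (series (fun m => Re (u m))).
  apply: is_cvg_norm_bounded_series vM => m; apply: le_trans (uv m).
  by rewrite -lecR; exact: normc_ge_Re.
have cIm : cvgn (series (fun m => Im (u m))).
  apply: is_cvg_norm_bounded_series vM => m; apply: le_trans (uv m).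
  exact: Im_le_normc.
have -> : series u = (fun n => (series (fun m => Re (u m)) n)%:C
                      + 'i * (series (fun m => Im (u m)) n)%:C).
  apply/funext => n; rewrite /series /= !rmorph_sum mulr_sumr -big_split /=.
  by apply: eq_bigr => m _; exact: complexE.
apply: is_cvgD.
  apply/cvg_ex; eexists; apply: (cvg_comp _ _ cRe).
  exact: real_complex_continuous.
apply: is_cvgMl_tmp; apply/cvg_ex; eexists; apply: (cvg_comp _ _ cIm).
exact: real_complex_continuous.
Qed.

Lemma normc_lim_series_le u v M :
  (forall m, normc (u m) <= v m) -> (forall n, series v n <= M) ->
  normc (limn (series u)) <= M.
Proof.
move=> uv vM; have cu := is_cvg_complex_series uv vM.
have cN : normc (series u n) @[n --> \oo] --> normc (limn (series u)).
  by apply: (cvg_comp _ _ cu); exact: normc_continuous.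
have E : limn (fun n => normc (series u n)) = normc (limn (series u)).
  exact: cvg_lim cN.
rewrite -E.
apply: limr_le; first by apply/cvg_ex; eexists; exact: cN.
apply: nearW => n; apply: le_trans (vM n).
rewrite /series /=; elim/big_ind2: _ => [|x1 x2 y1 y2 h1 h2|i _].
- by rewrite normc0.
- by apply: le_trans (normcD _ _) _; exact: lerD.
- exact: uv.
Qed.

End ComplexLimits.

(** * Telescoping bumps and their Taylor estimates *)

Section Bumps.
Variable R : realType.
Implicit Types (a b : R[i]) (c : R ^nat) (m n : nat) (r B : R).

Definition node m : R := 16^-1 ^+ m.

Lemma node_gt0 m : 0 < node m.
Proof. by rewrite exprn_gt0// invr_gt0. Qed.

Lemma nodeS m : node m.+1 = node m / 16.
Proof. by rewrite /node exprSr. Qed.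

Lemma node_le1 m : node m <= 1.
Proof. by rewrite exprn_ile1// ?invr_ge0// invf_le1//; lra. Qed.

Lemma series_node_le2 n : series node n <= 2.
Proof.
suff -> : series node n = 16 / 15 * (1 - node n) by have := node_gt0 n; lra.
elim: n => [|n IH]; first by rewrite /series/= big_geq// /node; lra.
by rewrite seriesSr IH nodeS; lra.
Qed.

(* This is [x / (x + t) - x / (x + s)], so sums over consecutive nodes
   telescope; on the positive axis it peaks between [t] and [s]. *)
Definition bump (K : fieldType) (s t x : K) : K :=
  x * (s - t) / ((x + s) * (x + t)).

Definition rbump m r : R := bump (node m) (node m.+1) r.

Definition cbump m a : R[i] := bump (node m)%:C (node m.+1)%:C a.

Lemma cbumpR m r : cbump m r%:C = (rbump m r)%:C.
Proof. by rewrite /cbump /rbump /bump !(rmorphM, rmorphB, rmorphD, fmorphV). Qed.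

Lemma rbump_ge0 m r : 0 <= r -> 0 <= rbump m r.
Proof.
move=> r0; have := node_gt0 m; have := node_gt0 m.+1; have := nodeS m => *.
by rewrite /rbump /bump divr_ge0 ?mulr_ge0//; lra.
Qed.

Lemma series_rbump r n : 0 <= r ->
  series (rbump^~ r) n = r / (r + node n) - r / (r + node 0).
Proof.
move=> r0; elim: n => [|n IH]; first by rewrite /series/= big_geq// subrr.
have := node_gt0 n; have := node_gt0 n.+1; have := node_gt0 0 => h0 h1 h2.
rewrite seriesSr IH /rbump /bump.
by field; rewrite !gt_eqF//; lra.
Qed.

(** For fixed [n] this bound vanishes with [r], which makes the head of a bump series small near 0;
    the bound 1 is uniform in [n] and [r]. *)
Lemma series_rbump_le r n : 0 <= r -> series (rbump^~ r) n <= r / node n.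
Proof.
move=> r0; rewrite series_rbump//; have := node_gt0 n; have := node_gt0 0 => h0 h1.
have : 0 <= r / (r + node 0) by rewrite divr_ge0//; lra.
have : r / (r + node n) <= r / node n.
  by rewrite ler_wpM2l// lef_pV2 ?posrE; lra.
lra.
Qed.

Lemma series_rbump_le1 r n : 0 <= r -> series (rbump^~ r) n <= 1.
Proof.
move=> r0; rewrite series_rbump//; have := node_gt0 n; have := node_gt0 0 => h0 h1.
have : 0 <= r / (r + node 0) by rewrite divr_ge0//; lra.
have : r / (r + node n) <= 1 by rewrite ler_pdivrMr; lra.
lra.
Qed.

Lemma normc_shift a r : 0 <= Re a -> 0 <= r ->
  normc a <= normc (a + r%:C).
Proof.
case: a => x y /= x0 r0; rewrite ler_wsqrtr// addr0 lerD2r.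
by rewrite lerXn2r ?nnegrE//; lra.
Qed.

Lemma le_normc_shift a r : Re a + r <= normc (a + r%:C).
Proof. by apply: le_trans (Re_le_normc _); rewrite raddfD. Qed.

(** For [q > 0], [|a + q|] is at least [|a|] and at least [q], hence at least [(|a| + q) / 2]. Each
    of the two factors of the denominator costs a factor 2. *)
Lemma normc_cbump m a : 0 <= Re a -> normc (cbump m a) <= 4 * rbump m (normc a).
Proof.
move=> a0; have q1 := node_gt0 m; have q2 := node_gt0 m.+1; have qS := nodeS m.
have N0 := normc_ge0 a.
have h (q : R) : 0 < q -> 0 < normc a + q -> (normc (a + q%:C))^-1 <= 2 / (normc a + q).
  move=> q0 aq; have := normc_shift a0 (ltW q0); have := le_normc_shift a q => h1 h2.
  have -> : 2 / (normc a + q) = ((normc a + q) / 2)^-1 by rewrite invfM invrK mulrC.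
  by rewrite lef_pV2 ?posrE; lra.
rewrite /cbump /rbump /bump !(normcM, normcV) -(rmorphB (real_complex R)) normcR.
rewrite ger0_norm; last lra.
have E : 4 * (normc a * (node m - node m.+1) /
  ((normc a + node m) * (normc a + node m.+1))) = normc a * (node m - node m.+1) *
   ((2 / (normc a + node m)) * (2 / (normc a + node m.+1))).
  by field; rewrite !gt_eqF//; lra.
rewrite E ler_wpM2l ?mulr_ge0//; first lra.
rewrite invfM ler_pM ?invr_ge0 ?normc_ge0//; apply: h; lra.
Qed.

(** The derivative of [cbump m] at [a]: that of [a / (a + q)] is [q / (a + q) ^ 2]. *)
Definition dbump m a : R[i] :=
  (node m.+1)%:C / (a + (node m.+1)%:C) ^+ 2 - (node m)%:C / (a + (node m)%:C) ^+ 2.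

Lemma normcX a k : normc (a ^+ k) = normc a ^+ k.
Proof. by elim: k => [|k IH]; rewrite ?normc1// !exprS normcM IH. Qed.

Lemma dshift_neq0 a (q : R) : 0 < Re a -> 0 < q -> a + q%:C != 0.
Proof.
move=> a0 q0; rewrite -normc_eq0 gt_eqF//; apply: lt_le_trans (le_normc_shift _ _).
lra.
Qed.

Lemma normc_dshift a (q : R) : 0 < Re a -> 0 < q ->
  normc (a + q%:C)^-1 <= (Re a)^-1.
Proof.
move=> a0 q0; have := le_normc_shift a q => h.
by rewrite normcV lef_pV2 ?posrE; lra.
Qed.

Lemma normc_dbump m a : 0 < Re a -> normc (dbump m a) <= 2 / Re a ^+ 2 * node m.
Proof.
move=> a0; have q1 := node_gt0 m; have q2 := node_gt0 m.+1; have qS := nodeS m.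
have h (q : R) : 0 < q -> normc (q%:C / (a + q%:C) ^+ 2) <= q / Re a ^+ 2.
  move=> q0; rewrite normcM normcR gtr0_norm// ler_wpM2l ?(ltW q0)//.
  rewrite -exprVn normcX -[(Re a ^+ 2)^-1]exprVn.
  by rewrite lerXn2r ?nnegrE ?normc_ge0 ?invr_ge0 ?(ltW a0)// normc_dshift.
apply: le_trans (normcD _ _) _; rewrite normcN.
apply: le_trans (lerD (h _ q2) (h _ q1)) _.
rewrite -mulrDl [leRHS]mulrAC ler_wpM2r ?invr_ge0 ?exprn_ge0//; lra.
Qed.

(** The factor [node m] makes these remainders summable over [m], so that bump sums can be
    differentiated termwise. *)
Lemma bump_taylor m a b : 0 < Re a -> 0 < Re b ->
  normc (cbump m b - cbump m a - dbump m a * (b - a)) <=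
  2 / (Re a ^+ 2 * Re b) * normc (b - a) ^+ 2 * node m.
Proof.
move=> a0 b0; have q1 := node_gt0 m; have q2 := node_gt0 m.+1; have qS := nodeS m.
(* Since [x / (x + q) = 1 - q / (x + q)], it is enough to know that [T q] is the exact first-order
   Taylor remainder of [q / (x + q)] from [a] to [b]. *)
pose T q := (b - a) ^+ 2 * (q%:C * ((a + q%:C)^-1 ^+ 2 * (b + q%:C)^-1)).
have -> : cbump m b - cbump m a - dbump m a * (b - a) = T (node m) - T (node m.+1).
  rewrite /T /dbump /cbump /bump.
  by field; rewrite !dshift_neq0.
have h (q : R) : 0 < q ->
    normc (T q) <= normc (b - a) ^+ 2 * (q * ((Re a)^-1 ^+ 2 * (Re b)^-1)).
  move=> q0; rewrite normcM normcX normcM normcR gtr0_norm// normcM normcX.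
  rewrite ler_wpM2l ?exprn_ge0 ?normc_ge0// ler_wpM2l ?(ltW q0)//.
  apply: ler_pM; rewrite ?exprn_ge0 ?normc_ge0 ?normc_dshift//.
  by rewrite lerXn2r ?nnegrE ?normc_ge0 ?invr_ge0 ?(ltW a0)// normc_dshift.
apply: le_trans (normcD _ _) _; rewrite normcN.
apply: le_trans (lerD (h _ q1) (h _ q2)) _.
rewrite -mulrDr -mulrDl.
have -> : 2 / (Re a ^+ 2 * Re b) * normc (b - a) ^+ 2 * node m =
   normc (b - a) ^+ 2 * (2 * node m * ((Re a)^-1 ^+ 2 * (Re b)^-1)).
  by field; rewrite !gt_eqF.
rewrite ler_wpM2l ?exprn_ge0 ?normc_ge0// ler_wpM2r//; last lra.
by rewrite mulr_ge0 ?exprn_ge0 ?invr_ge0// ltW.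
Qed.

Lemma series_scale_node_le (k : R) n : 0 <= k -> series (fun m => k * node m) n <= 2 * k.
Proof.
move=> k0; rewrite /series /= -mulr_sumr mulrC.
by rewrite ler_wpM2r//; exact: series_node_le2.
Qed.

Definition bumps c a : R[i] := limn (series (fun m => (c m)%:C * cbump m a)).

(** * Sums of bumps with bounded coefficients *)

Section BoundedCoefficients.
Variables (c : R ^nat) (B : R).
Hypothesis cB : forall m, 0 <= c m <= B.

Let c0 m : 0 <= c m. Proof. by case/andP: (cB m). Qed.
Let cleB m : c m <= B. Proof. by case/andP: (cB m). Qed.
Let B0 : 0 <= B. Proof. by apply: le_trans (c0 0) (cleB 0). Qed.

Lemma normc_bumps_term m a : 0 <= Re a ->
  normc ((c m)%:C * cbump m a) <= 4 * c m * rbump m (normc a).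
Proof.
move=> a0; rewrite normcM normcR (ger0_norm (c0 m)).
by rewrite mulrAC [leRHS]mulrC ler_wpM2l// normc_cbump.
Qed.

Lemma series_bumps_le a n :
  series (fun m => 4 * c m * rbump m (normc a)) n <= 4 * B.
Proof.
have N0 := normc_ge0 a.
apply: (@le_trans _ _ (4 * B * series (rbump^~ (normc a)) n)).
  rewrite /series /= mulr_sumr; apply: ler_sum => m _.
  by rewrite ler_wpM2r ?rbump_ge0// ler_wpM2l.
by rewrite ler_piMr ?mulr_ge0// series_rbump_le1.
Qed.

Lemma normc_bumps_le a : 0 <= Re a -> normc (bumps c a) <= 4 * B.
Proof.
move=> a0; apply: (normc_lim_series_le (v := fun m => 4 * c m * rbump m (normc a))).
  by move=> m; exact: normc_bumps_term.
exact: series_bumps_le.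
Qed.

Lemma is_cvg_bumps a : 0 <= Re a ->
  cvgn (series (fun m => (c m)%:C * cbump m a)).
Proof.
move=> a0; apply: (is_cvg_complex_series (v := fun m => 4 * c m * rbump m (normc a))).
  by move=> m; exact: normc_bumps_term.
exact: series_bumps_le.
Qed.

(** Cut the series at an [n] from which on [c m < e / 8]: for small [a] the head is at most [e / 4]
    by [series_rbump_le], and the tail is at most [e / 2] because the bumps sum to at most 1. *)
Lemma bumps_small (e : R) : c @ \oo --> 0 -> 0 < e ->
  exists2 d, 0 < d & forall a, 0 <= Re a -> normc a < d -> normc (bumps c a) < e.
Proof.
move=> /cvgr0Pnorm_lt cto0 e0.
have [n _ cn] : \forall m \near \oo, `|c m| < e / 8 by apply: cto0; lra.
have qn := node_gt0 n.
have Bp : 0 < B + 1 by rewrite ltr_wpDl.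
(* This radius bounds the head by [4 * B * e / (16 * (B + 1)) <= e / 4]; [B + 1] in place of [B]
   covers [B = 0]. *)
exists (e * node n / (16 * (B + 1))) => [|a a0 ad].
  by rewrite divr_gt0 ?mulr_gt0.
have N0 := normc_ge0 a.
apply: (@le_lt_trans _ _ (3 / 4 * e)); last lra.
apply: (normc_lim_series_le (v := fun m => 4 * c m * rbump m (normc a))).
  by move=> m; exact: normc_bumps_term.
move=> k.
have b0 m : 0 <= rbump m (normc a) by exact: rbump_ge0.
have v0 m : 0 <= 4 * c m * rbump m (normc a) by rewrite mulr_ge0// mulr_ge0.
(* Lengthening a partial sum of nonnegative terms makes it reach the cut at [n]. *)
apply: (@le_trans _ _ (series (fun m => 4 * c m * rbump m (normc a)) (n + k)%N)).
  by apply: nondecreasing_series => //; exact: leq_addl.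
rewrite {1}/series /= (big_cat_nat (n := n))//= ?leq_addr//.
have -> : 3 / 4 * e = 4 * B * (e / (16 * (B + 1))) + (3/4 * e - e/4 * (B / (B + 1))).
  by field; rewrite gt_eqF.
have B1 : B / (B + 1) <= 1 by rewrite ler_pdivrMr// mul1r lerDl.
have eB1 : e / 4 * (B / (B + 1)) <= e / 4 by rewrite ler_piMr//; lra.
apply: lerD.
  apply: (@le_trans _ _ (4 * B * series (rbump^~ (normc a)) n)).
    rewrite /series /= mulr_sumr; apply: ler_sum => m _.
    by rewrite ler_wpM2r// ler_wpM2l.
  rewrite ler_wpM2l ?mulr_ge0//; apply: le_trans (series_rbump_le _ N0) _.
  by rewrite ler_pdivrMr// mulrAC; exact: ltW.
apply: (@le_trans _ _ (e / 2)); last lra.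
apply: (@le_trans _ _ (e / 2 * series (rbump^~ (normc a)) (n + k)%N)); last first.
  by rewrite ler_piMr ?series_rbump_le1//; lra.
rewrite /series /= [in leRHS](big_cat_nat (n := n))//= ?leq_addr// mulrDr.
rewrite -[leLHS]add0r; apply: lerD.
  by rewrite mulr_ge0 ?sumr_ge0//; lra.
rewrite mulr_sumr big_nat_cond [leRHS]big_nat_cond.
apply: ler_sum => m /andP[/andP[nm _] _].
rewrite ler_wpM2r//; have := cn m nm; rewrite ger0_norm//; lra.
Qed.

Definition dbumps a := limn (series (fun m => (c m)%:C * dbump m a)).

(** The remainders of [bump_taylor] add up; the leading 2 bounds the sum of the [node m]. *)
Lemma bumps_taylor a b : 0 < Re a -> 0 < Re b ->
  normc (bumps c b - bumps c a - dbumps a * (b - a)) <=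
  2 * (B * (2 / (Re a ^+ 2 * Re b) * normc (b - a) ^+ 2)).
Proof.
move=> a0 b0.
have cD : cvgn (series (fun m => (c m)%:C * dbump m a)).
  apply: (is_cvg_complex_series (v := fun m => B * (2 / Re a ^+ 2) * node m)
   (M := 2 * (B * (2 / Re a ^+ 2)))).
    move=> m; rewrite normcM normcR ger0_norm// -mulrA ler_pM ?normc_ge0//.
    exact: normc_dbump.
  move=> n; apply: series_scale_node_le.
  by rewrite mulr_ge0 ?divr_ge0 ?exprn_ge0// ltW.
pose u m := (c m)%:C * (cbump m b - cbump m a - dbump m a * (b - a)).
have -> : bumps c b - bumps c a - dbumps a * (b - a) = limn (series u).
  apply/esym/cvg_lim; first exact: norm_hausdorff.
  have -> : series u = (fun n => series (fun m => (c m)%:C * cbump m b) n -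
     series (fun m => (c m)%:C * cbump m a) n -
     series (fun m => (c m)%:C * dbump m a) n * (b - a)).
    apply/funext => n; rewrite /series /= mulr_suml -!sumrB; apply: eq_bigr => m _.
    by rewrite /u; ring.
  apply: (cvgB (cvgB (is_cvg_bumps (ltW b0)) (is_cvg_bumps (ltW a0)))).
  exact: cvgMr_tmp cD.
apply: (normc_lim_series_le
  (v := fun m => B * (2 / (Re a ^+ 2 * Re b) * normc (b - a) ^+ 2) * node m)).
  move=> m; rewrite normcM normcR ger0_norm// -mulrA ler_pM ?normc_ge0//.
  exact: bump_taylor.
move=> n; apply: series_scale_node_le.
by rewrite !mulr_ge0 ?invr_ge0 ?mulr_ge0 ?exprn_ge0 ?normc_ge0// ltW.
Qed.

Lemma differentiable_bumps a : 0 < Re a -> differentiable (bumps c) a.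
Proof.
move=> a0; apply/derivable1_diffP/cvg_ex; exists (dbumps a).
apply/(cvg_normcP (F := 0^')) => e e0.
(* [K] is the constant of [bumps_taylor] with [Re b] lowered to [Re a / 2], which [|h| < Re a / 2]
   will justify. *)
pose K := 2 * (B * (2 / (Re a ^+ 2 * (Re a / 2)))).
have K0 : 0 <= K by rewrite !mulr_ge0 ?invr_ge0 ?mulr_ge0 ?exprn_ge0// ltW.
have d0 : 0 < Num.min (Re a / 2) (e / (K + 1)).
  by rewrite lt_min !divr_gt0//; lra.
near=> h.
have h0 : h != 0 by near: h; exact: nbhs_dnbhs_neq.
have : normc (0 - h) < Num.min (Re a / 2) (e / (K + 1)).
  by near: h; apply: nbhs_dnbhs; exact: near_normc.
rewrite sub0r normcN lt_min => /andP[ha he].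
have Reb : Re a / 2 < Re (h + a).
  rewrite raddfD /=; have := Re_le_normc (- h); rewrite normcN raddfN /=; lra.
have b0 : 0 < Re (h + a) by lra.
rewrite /= [h%:A]mulr1 normcB.
have Nh : 0 < normc h by rewrite lt_neqAle normc_ge0 eq_sym normc_eq0 h0.
have -> : h^-1 *: (bumps c (h + a) - bumps c a) - dbumps a =
   h^-1 * (bumps c (h + a) - bumps c a - dbumps a * (h + a - a)).
  by rewrite addrK mulrBr mulrCA mulVf// mulr1.
rewrite normcM normcV ltr_pdivrMl//.
apply: le_lt_trans (bumps_taylor a0 b0) _.
apply: (@le_lt_trans _ _ (K * normc h ^+ 2)).
  rewrite addrK /K -!mulrA ler_wpM2l// ler_wpM2l// ler_wpM2l//.
  rewrite ler_wpM2r ?exprn_ge0 ?normc_ge0//.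
  by rewrite lef_pV2 ?posrE ?mulr_gt0 ?exprn_gt0// ?ler_wpM2l ?exprn_ge0 ?(ltW a0)//; lra.
rewrite expr2 mulrA mulrC ltr_pM2l//.
move: he; rewrite ltr_pdivlMr; lra.
Unshelve. all: by end_near. Qed.

End BoundedCoefficients.

End Bumps.

(** * From functions on the right half-plane to the polydisk algebra *)

Section Membership.
Variables (R : realType) (n : nat) (j : 'I_n).
Implicit Types (a : R[i]) (G : R[i] -> R[i]) (u : @polydisk R n).

(** The closed unit disk meets the half-plane [Re >= 1] only at 1. *)
Lemma half_plane a : `|a| <= 1 -> 1 - a = 0 \/ 0 < Re (1 - a).
Proof.
case: a => x y; rewrite norm_normc lecR => h.
have xy : x ^+ 2 + y ^+ 2 <= 1.
  have s0 : 0 <= x ^+ 2 + y ^+ 2 by rewrite addr_ge0 ?sqr_ge0.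
  by rewrite -(sqr_sqrtr s0) expr_le1// sqrtr_ge0.
have [x1|x1] := ltP x 1; [right; rewrite raddfB /=; lra|left].
have y0 := sqr_ge0 y; have y2 : y ^+ 2 = 0 by nra.
have -> : y = 0 by apply/eqP; rewrite -sqrf_eq0 y2.
have -> : x = 1 by nra.
by rewrite complexr0 rmorph1 subrr.
Qed.

Lemma polydisk_half_plane u : 1 - val u ord0 j = 0 \/ 0 < Re (1 - val u ord0 j).
Proof. by apply: half_plane; exact: (set_mem (valP u)). Qed.

Lemma interior_half_plane (z : 'rV[R[i]]_n) :
  interior (@polydisk R n) z -> 0 < Re (1 - z ord0 j).
Proof.
move=> zi; have [z1|//] : 1 - z ord0 j = 0 \/ 0 < Re (1 - z ord0 j).
  by apply: half_plane; exact: (interior_subset zi).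
have /nbhs_ballP[e /= e0 eD] := zi.
have e20 : 0 < e / 2 by rewrite divr_gt0.
(* If [z_j = 1], moving every coordinate by [e / 2] stays in the ball contained in the polydisk, yet
   gives modulus [1 + e / 2] at [j]. *)
have /eD/(_ j) : ball z e (z + const_mx (e / 2)).
  split=> // i k; rewrite /ball /= !mxE opprD addNKr normrN gtr0_norm//.
  by rewrite ltr_pdivrMr// ltr_pMr// ltrDl.
have zE : z ord0 j = 1 by rewrite -(subKr 1 (z ord0 j)) z1 subr0.
rewrite !mxE zE (gtr0_norm (addr_gt0 ltr01 e20)) gerDl => /le_gtF.
by rewrite e20.
Qed.

Definition pullback G u : R[i] := G (1 - val u ord0 j).

Lemma coord_polydisk_continuous u :
  (fun w : @polydisk R n => val w ord0 j) @ u --> val u ord0 j.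
Proof.
apply: (@continuous_comp _ _ _ (fun w : @polydisk R n => val w)
  (fun z : 'rV[R[i]]_n => z ord0 j)).
  exact: (@initial_continuous _ _ (fun w : @polydisk R n => val w)).
exact: coord_continuous.
Qed.

Lemma differentiable_pullback G (z : 'rV[R[i]]_n) : differentiable G (1 - z ord0 j) ->
  differentiable (fun z : 'rV[R[i]]_n => G (1 - z ord0 j)) z.
Proof.
move=> dG.
apply: (@differentiable_comp _ _ _ _ (fun z : 'rV[R[i]]_n => 1 - z ord0 j) G) dG.
by apply: differentiableB => //; exact: differentiable_coord.
Qed.

(** Off [z_j = 1] the point [1 - z_j] lies in the open right half-plane, where [G] is
    differentiable. The remaining points map to 0, where continuity within the closed half-plane is
    enough. *)
Lemma pullback_in_polydisk_algebra G :
  (forall a, 0 < Re a -> differentiable G a) ->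
  (forall e, 0 < e -> exists2 d, 0 < d &
    forall a, 0 <= Re a -> normc a < d -> normc (G 0 - G a) < e) ->
  pullback G \in @in_polydisk_algebra R n.
Proof.
move=> dG cG; apply/asboolP; split.
  move=> u.
  have cu : (fun w : @polydisk R n => 1 - val w ord0 j) @ u --> 1 - val u ord0 j.
    exact: (cvgB (F := nbhs u) (cvg_cst (1 : R[i]))
      (coord_polydisk_continuous (u := u))).
  have [u1|/dG du] := polydisk_half_plane u; last first.
    exact: (cvg_comp _ _ cu (differentiable_continuous du)).
  apply/(cvg_normcP (F := nbhs u)) => e /cG[d d0 dGe].
  apply: (filterS (F := nbhs u)) ((cvg_normcP (F := nbhs u) _ _).1 cu d d0) => w.
  rewrite /pullback u1 sub0r normcN; apply: dGe.
  by have [->|/ltW] := polydisk_half_plane w.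
move=> z zi; apply: near_eq_differentiable; last first.
  apply: differentiable_pullback; apply: dG; exact: interior_half_plane.
apply: filterS zi => w Dw /=.
by rewrite oinv_set_val insubT ?inE.
Qed.

(* The point [(1 - x, .., 1 - x)]; clamping [x] makes it total, and it is only
   used for [0 <= x <= 1]. *)
Lemma diagonal_subproof (x : R) :
  const_mx (1 - Num.min 1 `|x|)%:C \in @polydisk R n.
Proof.
apply/mem_set => k; rewrite mxE norm_normc normcR lecR ger0_norm.
  by rewrite gerBl le_min ler01 normr_ge0.
by rewrite subr_ge0 ge_min lexx.
Qed.

Definition diagonal (x : R) : @polydisk R n :=
  exist (fun z => z \in @polydisk R n) _ (diagonal_subproof x).

Lemma pullback_diagonal G (x : R) : 0 <= x <= 1 -> pullback G (diagonal x) = G x%:C.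
Proof.
move=> /andP[x0 x1]; rewrite /pullback /= mxE ger0_norm// min_r//.
by rewrite -(rmorph1 (real_complex R)) -rmorphB subKr.
Qed.

Lemma diagonal_continuous : continuous diagonal.
Proof.
move=> x; have cx : val (diagonal y) @[y --> x] --> val (diagonal x).
  have cy : (1 - Num.min 1 `|y|)%:C @[y --> x] --> (1 - Num.min 1 `|x|)%:C.
    have cm : (fun y : R => 1 - Num.min 1 `|y|) @ x --> 1 - Num.min 1 `|x|.
      apply: cvgB; first exact: cvg_cst.
      by apply: (@continuous_min R R (cst 1) Num.norm x);
        [exact: cvg_cst|exact: norm_continuous].
    exact: (cvg_comp _ _ cm (real_complex_continuous (x := _))).
  move=> A /nbhs_ballP[e /= e0 eA].
  apply: (filterS (F := nbhs x)) ((cvgrPdist_lt (F := nbhs x) _ _).1 cy e e0).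
  by move=> y xy; apply: eA; split=> // i k; rewrite /ball /= !mxE.
(* The polydisk carries the initial topology of [val]: its open sets are preimages of open sets
   [U]. *)
move=> A; rewrite nbhsE => -[_ [[U oU <-] Ux] UA].
have := cx _ (open_nbhs_nbhs (conj oU Ux)).
by apply: (filterS (F := nbhs x)) => y; exact: UA.
Qed.

End Membership.

(** * Values of bump sums at the peaks *)

Section Peaks.
Variable R : realType.
Implicit Types (c : R ^nat) (m n : nat) (x B : R).

(** The geometric mean of [node m] and [node m.+1], where [rbump m] is largest on the positive
    axis. *)
Definition peak m : R := node R m / 4.

Lemma peak_gt0 m : 0 < peak m.
Proof. by rewrite divr_gt0// node_gt0. Qed.

Lemma peak_le1 m : 0 <= peak m <= 1.
Proof. rewrite ltW ?peak_gt0// /peak; have := node_le1 R m; lra. Qed.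

Lemma cvg_peak : peak @ \oo --> 0.
Proof.
rewrite -[X in _ --> X](mul0r 4^-1); apply: cvgMr_tmp.
by apply: cvg_expr; rewrite ger0_norm ?invr_ge0// invf_lt1//; lra.
Qed.

Lemma rbump_peak m : rbump m (peak m) = 3 / 5.
Proof.
rewrite /rbump /bump /peak nodeS; have := node_gt0 R m => h.
by field; rewrite gt_eqF//=; lra.
Qed.

Lemma bumps0 c : bumps c 0 = 0.
Proof.
apply/cvg_lim; first exact: norm_hausdorff.
rewrite (_ : series _ = fun=> 0); first exact: cvg_cst.
apply/funext => n; rewrite /series /= big1// => m _.
by rewrite /cbump /bump !mul0r mulr0.
Qed.

Section RealValues.
Variables (c : R ^nat) (B : R).
Hypothesis cB : forall m, 0 <= c m <= B.

Let c0 m : 0 <= c m. Proof. by case/andP: (cB m). Qed.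

Lemma is_cvg_rbumps x : 0 <= x -> cvgn (series (fun m => c m * rbump m x)).
Proof.
move=> x0; apply: (@is_cvg_bounded_series _ _ B) => [m|n].
  by rewrite mulr_ge0// rbump_ge0.
have B0 : 0 <= B by case/andP: (cB 0) => h; exact: le_trans.
have : series (fun m => c m * rbump m x) n <= B * series (fun m => rbump m x) n.
  rewrite /series /= mulr_sumr; apply: ler_sum => m _.
  by rewrite ler_wpM2r ?rbump_ge0//; case/andP: (cB m).
by move/le_trans; apply; rewrite ler_piMr// series_rbump_le1.
Qed.

Lemma bumps_real x : 0 <= x ->
  bumps c x%:C = (limn (series (fun m => c m * rbump m x)))%:C.
Proof.
move=> x0; apply/cvg_lim; first exact: norm_hausdorff.
have -> : series (fun m => (c m)%:C * cbump m x%:C) =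
    (fun n => (series (fun m => c m * rbump m x) n)%:C).
  apply/funext => n; rewrite /series /= rmorph_sum; apply: eq_bigr => m _.
  by rewrite cbumpR -(rmorphM (real_complex R)).
exact: (cvg_comp _ _ (is_cvg_rbumps x0) (real_complex_continuous (x := _))).
Qed.

Lemma series_rbumps_nd x : 0 <= x ->
  nondecreasing_seq (series (fun m => c m * rbump m x)).
Proof.
by move=> x0; apply: nondecreasing_series => m _ _; rewrite mulr_ge0// rbump_ge0.
Qed.

Lemma bumps_peak_ge m : 3 / 5 * c m <= normc (bumps c (peak m)%:C).
Proof.
have x0 := ltW (peak_gt0 m).
rewrite bumps_real// normcR (le_trans _ (ler_norm _))//.
apply: le_trans (nondecreasing_cvgn_le (series_rbumps_nd x0) (is_cvg_rbumps x0) m.+1).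
rewrite seriesSr rbump_peak mulrC lerDr sumr_ge0// => k _.
by rewrite mulr_ge0// rbump_ge0.
Qed.

(** The [m]-th bump alone takes 3/5 of a telescoping total of at most 1, so the others, with
    coefficients at most 1, give at most 2/5. *)
Lemma bumps_peak_le m : B <= 1 -> c m = 0 ->
  normc (bumps c (peak m)%:C) <= 2 / 5.
Proof.
move=> B1 cm; have x0 := ltW (peak_gt0 m).
have L0 := nondecreasing_cvgn_le (series_rbumps_nd x0) (is_cvg_rbumps x0) 0.
rewrite bumps_real// normcR ger0_norm; last first.
  by apply: le_trans L0; rewrite /series /= big_geq.
apply: limr_le; first exact: is_cvg_rbumps.
apply: nearW => n.
(* Partial sums of length [n + m.+1] contain the index [m], which can then be split off. *)
apply: le_trans (series_rbumps_nd x0 (leq_addr m.+1 n)) _.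
have := @series_rbump_le1 R (peak m) (n + m.+1) x0.
rewrite /series /= !(bigD1_seq m) ?iota_uniq//= ?mem_index_iota ?addnS ?ltnS ?leq_addl//.
rewrite rbump_peak cm mul0r add0r => h.
apply: (@le_trans _ _ (1 - 3/5)); last lra.
rewrite lerBrDl; apply: le_trans h; rewrite lerD2l; apply: ler_sum => k _.
rewrite ler_piMl ?rbump_ge0//; case/andP: (cB k) => _ /le_trans; exact.
Qed.

End RealValues.
End Peaks.

(** * Evaluation along the diagonal *)

Section NonCoherence.
Variables (R : realType) (n : nat) (j : 'I_n).
Notation A := (polydisk_algebra R n).

Definition pullback_elt G (GA : pullback j G \in @in_polydisk_algebra R n) : A :=
  exist (fun f => f \in @in_polydisk_algebra R n) _ GA.

Definition ev (x : R) (f : A) : R[i] := val f (diagonal n x).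

Lemma evD x f g : ev x (f + g) = ev x f + ev x g.
Proof. by []. Qed.

Lemma evM x f g : ev x (f * g) = ev x f * ev x g.
Proof. by []. Qed.

Lemma ev_sum x (I : finType) (F : I -> A) : ev x (\sum_i F i) = \sum_i ev x (F i).
Proof. exact: (big_morph (ev x) (evD x) erefl). Qed.

Lemma ev_pullback x G (GA : pullback j G \in @in_polydisk_algebra R n) :
  0 <= x <= 1 -> ev x (pullback_elt GA) = G x%:C.
Proof. exact: pullback_diagonal. Qed.

Lemma cvg_ev (x : R ^nat) f : x @ \oo --> 0 -> ev (x k) f @[k --> \oo] --> ev 0 f.
Proof.
move=> x0; have /asboolP[cf _] := valP f.
have cd : (diagonal n (x k)) @[k --> \oo] --> diagonal n 0.
  exact: (cvg_comp _ _ x0 (diagonal_continuous (x := _))).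
exact: (cvg_comp _ _ cd (cf _)).
Qed.

End NonCoherence.

(** * Elements of the algebra built from bump sums *)

Section Witnesses.
Variables (R : realType) (n : nat) (j : 'I_n).

Definition even_coef : R ^nat := fun m => (~~ odd m)%:R.

Lemma even_coef_bound m : 0 <= even_coef m <= 1.
Proof. by rewrite /even_coef; case: odd; rewrite ?lexx ?ler01. Qed.

(** The function S: bounded on the closed half-plane, but with moduli kept apart at even and odd
    peaks. *)
Definition wild (a : R[i]) : R[i] := bumps even_coef a.

Lemma normc_wild_le a : 0 <= Re a -> normc (wild a) <= 4.
Proof. by move=> a0; have := normc_bumps_le even_coef_bound a0; rewrite mulr1. Qed.

Lemma normc_wild_even k : 3 / 5 <= normc (wild (peak R k.*2)%:C).
Proof.
have := bumps_peak_ge even_coef_bound k.*2.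
by rewrite {1}/even_coef odd_double mulr1.
Qed.

Lemma normc_wild_odd k : normc (wild (peak R k.*2.+1)%:C) <= 2 / 5.
Proof.
by apply: (bumps_peak_le even_coef_bound) => //; rewrite /even_coef /= odd_double.
Qed.

Lemma pullback_id_in : pullback j id \in @in_polydisk_algebra R n.
Proof.
apply: pullback_in_polydisk_algebra => [a _|e e0]; first exact: ex_diff.
by exists e => // a _; rewrite sub0r normcN.
Qed.

(** The factor [a] restores continuity at 0, since [|a S(a)| <= 4 |a|]. *)
Lemma pullback_wild_in : pullback j (fun a => a * wild a) \in @in_polydisk_algebra R n.
Proof.
apply: pullback_in_polydisk_algebra => [a a0|e e0].
  apply: differentiableM; first exact: ex_diff.
  exact: (differentiable_bumps even_coef_bound).
exists (e / 4) => [|a a0 ad]; first by rewrite divr_gt0.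
rewrite mul0r sub0r normcN normcM.
have h1 := normc_wild_le a0; have h2 := normc_ge0 a; have h3 := normc_ge0 (wild a).
nra.
Qed.

Section VanishingCoefficients.
Variables (c : R ^nat) (B : R).
Hypothesis cB : forall m, 0 <= c m <= B.
Hypothesis c0 : c @ \oo --> 0.

Lemma pullback_bumps_in : pullback j (bumps c) \in @in_polydisk_algebra R n.
Proof.
apply: pullback_in_polydisk_algebra => [a a0|e e0].
  exact: differentiable_bumps cB _ a0.
have [d d0 dc] := bumps_small cB c0 e0.
by exists d => // a; rewrite bumps0 sub0r normcN; exact: dc.
Qed.

(** Near 0 the decay of [bumps c] outweighs the factor [wild], whose modulus is at most 4. *)
Lemma pullback_bumps_wild_in :
  pullback j (fun a => bumps c a * wild a) \in @in_polydisk_algebra R n.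
Proof.
apply: pullback_in_polydisk_algebra => [a a0|e e0].
  apply: differentiableM; first exact: differentiable_bumps cB _ a0.
  exact: (differentiable_bumps even_coef_bound).
have e4 : 0 < e / 4 by rewrite divr_gt0.
have [d d0 dc] := bumps_small cB c0 e4.
exists d => // a a0 /(dc _ a0); rewrite bumps0 mul0r sub0r normcN normcM.
have h1 := normc_wild_le a0.
have h2 := normc_ge0 (bumps c a); have h3 := normc_ge0 (wild a).
nra.
Qed.

End VanishingCoefficients.
End Witnesses.

(** * Subsequences, ideals and the final contradiction *)

Lemma cvg_subsequence (T : topologicalType) (u : nat -> T) (l : T) (f : nat -> nat) :
  (forall k, (k <= f k)%N) -> u @ \oo --> l -> (u \o f) @ \oo --> l.
Proof.
move=> kf; apply: cvg_comp => P [N _ NP]; exists N => // k /= Nk.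
by apply: NP; exact: leq_trans (kf k).
Qed.

Lemma ideal_gen1 (A : comPzRingType) (s x : A) :
  ideal_gen [:: s] x <-> exists y, x = y * s.
Proof.
split=> [[c ->]|[y ->]]; first by exists (c ord0); rewrite big_ord1.
by exists (fun=> y); rewrite big_ord1.
Qed.

Lemma mem_ideal_gen (A : comPzRingType) (s : seq A) (x : A) :
  x \in s -> ideal_gen s x.
Proof. by move=> xs; rewrite ideal_genE => I [_]; exact. Qed.

Lemma not_coherent_polydisk_algebra (R : realType) (n : nat) (j : 'I_n) :
  ~ coherent (polydisk_algebra R n).
Proof.
pose A := polydisk_algebra R n => coh.
(* With [a = 1 - z_j], these two elements are [a] and [a S]. *)
pose p : A := pullback_elt (pullback_id_in R j).
pose pS : A := pullback_elt (pullback_wild_in R j).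
have [|| g gE] := coh (ideal_gen [:: p]) (ideal_gen [:: pS]); [by eexists..|].
have /choice[hk hkE] : forall i : 'I_(size g), exists hk : A * A,
    g`_i = hk.1 * p /\ g`_i = hk.2 * pS.
  move=> i; have : ideal_gen g g`_i by apply: mem_ideal_gen; exact: mem_nth.
  by rewrite -gE => -[/ideal_gen1[h hE] /ideal_gen1[k kE]]; exists (h, k).
pose H i := (hk i).1; pose K i := (hk i).2.
have peakC m : (peak R m)%:C != 0.
  by rewrite -normc_eq0 normcR normr_eq0 gt_eqF// peak_gt0.
(* At a peak both expressions of the generator carry the nonzero factor [peak R m], which
   cancels. *)
have HK i m : ev (peak R m) (H i) = ev (peak R m) (K i) * wild (peak R m)%:C.
  have [h1 h2] := hkE i.
  have : ev (peak R m) (H i * p) = ev (peak R m) (K i * pS) by rewrite -h1 h2.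
  rewrite !evM /p /pS !ev_pullback ?peak_le1// mulrCA mulrC.
  exact: mulfI.
have cN (x : R ^nat) (f : A) : x @ \oo --> 0 ->
    (fun k => normc (ev (x k) f)) @ \oo --> normc (ev 0 f).
  move=> x0; exact: (cvg_comp _ _ (cvg_ev (f := f) x0) (normc_continuous (x := _))).
have le_double k : (k <= k.*2)%N by rewrite -addnn leq_addr.
have ceven := cvg_subsequence le_double (@cvg_peak R).
have codd := cvg_subsequence (fun k => leqW (le_double k)) (@cvg_peak R).
(* Limits along even and odd peaks give [3/5 |K i| <= |H i| <= 2/5 |K i|] at 0. *)
have K0 i : normc (ev 0 (K i)) = 0.
  have h1 : 3 / 5 * normc (ev 0 (K i)) <= normc (ev 0 (H i)).
    have cK : (fun k => 3 / 5 * normc (ev (peak R k.*2) (K i))) @ \oo -->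
        3 / 5 * normc (ev 0 (K i)) by exact: cvgMl_tmp (cN _ _ ceven).
    apply: (ler_cvg_to cK (cN _ _ ceven)).
    apply: nearW => k; rewrite HK normcM mulrC ler_wpM2l ?normc_ge0//.
    exact: normc_wild_even.
  have h2 : normc (ev 0 (H i)) <= 2 / 5 * normc (ev 0 (K i)).
    have cK : (fun k => 2 / 5 * normc (ev (peak R k.*2.+1) (K i))) @ \oo -->
        2 / 5 * normc (ev 0 (K i)) by exact: cvgMl_tmp (cN _ _ codd).
    apply: (ler_cvg_to (cN _ _ codd) cK).
    apply: nearW => k; rewrite HK normcM [leRHS]mulrC ler_wpM2l ?normc_ge0//.
    exact: normc_wild_odd.
  have := normc_ge0 (ev 0 (K i)); lra.
(* With [c] the square root of [d], [c ^ 2] dominates each [|K i|] at the peaks while [c] still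
   tends to 0; the summand [peak R m] keeps [c] positive, so that it can be divided out. *)
pose d m : R := \sum_i normc (ev (peak R m) (K i)) + peak R m.
have sum_ge0 m : 0 <= \sum_i normc (ev (peak R m) (K i)).
  by apply: sumr_ge0 => i _; exact: normc_ge0.
have d_gt0 m : 0 < d m by rewrite ltr_wpDl// peak_gt0.
pose c m : R := Num.sqrt (d m).
have c_gt0 m : 0 < c m by rewrite sqrtr_gt0.
have c0 : c @ \oo --> 0.
  have d0 : d @ \oo --> 0.
    rewrite -[X in _ --> X]addr0; apply: cvgD (@cvg_peak R).
    rewrite -[X in _ --> X](_ : \sum_(i < size g) normc (ev 0 (K i)) = 0); last first.
      by apply: big1 => i _; exact: K0.
    apply: cvg_big => [|i _]; first exact: add_continuous.
    exact: cN (@cvg_peak R).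
  rewrite -(sqrtr0 R); apply: (cvg_comp _ _ d0); exact: sqrt_continuous.
have /cvg_seq_bounded/bounded_fun_has_ubound[B cB'] : cvgn c by apply/cvg_ex; exists 0.
have cB m : 0 <= c m <= B by rewrite ltW//=; apply: cB'; exists m.
pose f : A := pullback_elt (pullback_bumps_in j cB c0).
pose fS : A := pullback_elt (pullback_bumps_wild_in j cB c0).
(* As [f * pS = fS * p], this product lies in both principal ideals. *)
have [al alE] : ideal_gen g (f * pS).
  rewrite -gE; split; apply/ideal_gen1; last by exists f.
  exists fS; apply/val_inj/funext => u.
  have mulACB (x y z : R[i]) : x * (y * z) = x * z * y by rewrite mulrCA mulrC.
  exact: mulACB.
have key k : 3 / 5 <= (\sum_i normc (ev (peak R k.*2) (al i))) * c k.*2.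
  set x := peak R k.*2.
  have W0 : wild x%:C != 0.
    rewrite -normc_eq0 gt_eqF//; apply: lt_le_trans (normc_wild_even R k); lra.
  (* The index is even, so [wild] is nonzero at [x] and the factor [x * wild x] coming from [pS]
     cancels. *)
  have E : bumps c x%:C = \sum_i ev x (al i) * ev x (K i).
    have : ev x (f * pS) = ev x (\sum_i al i * g`_i) by rewrite alE.
    rewrite evM !ev_pullback ?peak_le1// ev_sum.
    under eq_bigr => i _ do rewrite (hkE i).2 !evM ev_pullback ?peak_le1// mulrA.
    by rewrite -mulr_suml; apply: mulIf; rewrite mulf_neq0 ?peakC.
  have := bumps_peak_ge cB k.*2; rewrite -/x E => h.
  (* Multiplying by [c] brings in [c ^ 2 = d], which bounds every [|K i|]. *)
  rewrite -(ler_pM2r (c_gt0 k.*2)); apply: le_trans h _.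
  rewrite -mulrA -expr2 sqr_sqrtr ?(ltW (d_gt0 _))// mulr_suml.
  elim/big_ind2: _ => [|u v w z h1 h2|i _]; first by rewrite normc0.
    by apply: le_trans (normcD _ _) _; exact: lerD.
  rewrite normcM ler_wpM2l ?normc_ge0//.
  rewrite /d (bigD1 i)//= -addrA lerDl addr_ge0 ?(ltW (peak_gt0 _ _))//.
  by apply: sumr_ge0 => l _; exact: normc_ge0.
have csum : (fun k => \sum_i normc (ev (peak R k.*2) (al i))) @ \oo -->
    \sum_i normc (ev 0 (al i)).
  apply: cvg_big => [|i _]; first exact: add_continuous.
  exact: cN ceven.
(* The sum converges by continuity of the [al i], while [c] tends to 0. *)
have : (3 / 5 : R) <= (\sum_i normc (ev 0 (al i))) * 0.
  exact: ler_cvg_to (cvg_cst _) (cvgM csum (cvg_subsequence le_double c0))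
    (nearW _ key).
by rewrite mulr0; lra.
Qed.

Theorem theorem4p2 (R : realType) (n : nat) (hn : (1 <= n)%N) :
  ~ coherent (polydisk_algebra R n).
Proof. exact: not_coherent_polydisk_algebra (Ordinal hn). Qed.
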